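(* Let $Q>0$ (the vehicle capacity) and let $S$ be a finite set of customers whose demands $\xi_i$, $i\in S$, are independent normal random variables, $\xi_i\sim\mathcal{N}(\mu_i,\sigma_i^2)$, with positive integer expected values $\mu_i$, sharing a common coefficient of dispersion $D=\sigma_i^2/\mu_i\le 1$ for all $i\in S$, and with total expected value $\sum_{i\in S}\mu_i\le Q$. Then $S$ respects the monotonicity condition.
   Context: Monotonicity condition: a finite set $S$ of customers with independent random demands $\xi_i$ ($i\in S$) respects the monotonicity condition (with respect to the capacity $Q$) if, for every pair $(a,b)\in S\times S$ with $a\ne b$, every subset $\tilde S\subseteq S\setminus\{a,b\}$ (possibly empty) and every positive integer $l$, $$\mathbb{P}\left(\tilde\xi+\xi_a\le lQ<\tilde\xi+\xi_a+\xi_b\right)\ \ge\ \mathbb{P}\left(\tilde\xi\le lQ<\tilde\xi+\xi_b\right),\qquad \tilde\xi=\sum_{i\in\tilde S}\xi_i .$$ *)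

(* Defs.v *)
From mathcomp Require Import all_boot all_order all_algebra.
From mathcomp Require Import all_classical all_reals all_analysis.

Set Implicit Arguments.
Unset Strict Implicit.
Unset Printing Implicit Defensive.

Import Order.TTheory GRing.Theory Num.Theory.

Local Open Scope classical_set_scope.
Local Open Scope ring_scope.

(* The index set S may be a proper part of I: nothing is required of X i for
   i outside S. *)
Definition independent_on (d : measure_display) (T : measurableType d)
    (R : realType) (P : probability T R) (I : finType) (S : {set I})
    (X : I -> {RV P >-> R}) : Prop :=
  forall (J : {set I}) (B : I -> set R),
    J \subset S ->
    (forall i, i \in J -> measurable (B i)) ->
    P (\bigcap_(i in [set` J]) (X i @^-1` B i)) =
      (\prod_(i in J) P (X i @^-1` B i))%E.

(* normal_prob takes the standard deviation s, not the variance; for s = 0 it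
   is the uniform law on [0, 1], so s must be nonzero for it to be normal. *)
Definition has_normal_law (d : measure_display) (T : measurableType d)
    (R : realType) (P : probability T R) (X : {RV P >-> R}) (m s : R) : Prop :=
  0 < s /\
  forall A : set R, measurable A -> distribution P X A = normal_prob m s A.

Definition monotonicity_condition (d : measure_display)
    (T : measurableType d) (R : realType) (P : probability T R) (Q : R)
    (I : finType) (S : {set I}) (xi : I -> {RV P >-> R}) : Prop :=
  forall (a b : I), a \in S -> b \in S -> a != b ->
  forall (U : {set I}), U \subset S :\: [set a; b]%SET ->
  forall l : nat, (0 < l)%N ->
    (P [set w | (\sum_(i in U) xi i w <= l%:R * Q)%R /\
                (l%:R * Q < \sum_(i in U) xi i w + xi b w)%R] <=
     P [set w | (\sum_(i in U) xi i w + xi a w <= l%:R * Q)%R /\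
                (l%:R * Q < \sum_(i in U) xi i w + xi a w + xi b w)%R])%E.

(* Main.v *)
(* Dividing every demand by D, one may think of variances equal to the means, so
   that all sums are N(t, t) variables for some t; put H(t) = P(N(t, t) > L)
   with L = l Q / D.  For X independent of B,
     P(X <= L < X + B) = P(X + B > L) - P(X > L) + P(X > L >= X + B).
   The last term grows when X is replaced by X + A, because beyond L the density
   of N(t + a, t + a) dominates that of N(t, t).  It remains to see that
     H(m + a) - H(m) <= H(m + a + b) - H(m + b)
   for a, b >= 1 and m + a + b <= L.  The derivative H' is nondecreasing on
   ]0, c] with c = L - 1, which settles m + a + b <= c.  In general
   m + a + b = c + r with 0 <= r <= 1, and the increment of H over [c, c + r] is
   at least that over [c - r, c], since H'(c - e) <= H'(c + e). *)

From HB Require Import structures.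
Require Import Defs.
From mathcomp Require Import all_boot all_order all_algebra.
From mathcomp Require Import all_classical all_reals all_analysis.
From mathcomp Require Import measurable_realfun ring lra.

Import Order.TTheory GRing.Theory Num.Theory.
Import numFieldNormedType.Exports.

Local Open Scope classical_set_scope.
Local Open Scope ring_scope.

Set Implicit Arguments.
Unset Strict Implicit.
Unset Printing Implicit Defensive.

(** * Growth of the log-density below [L - 1] *)

Section log_density.
Context {R : realType}.
Implicit Types L c r t : R.

(* The logarithm, up to an additive constant, of the derivative in t of
   P(N(t, t) > L). *)
Definition log_tail_deriv L t : R :=
  - ((L - t) ^+ 2 / (2 * t)) + ln (L + t) - 3 / 2 * ln t.

Lemma is_derive_log_tail_deriv L t : 0 <= L -> 0 < t ->
  is_derive t 1 (log_tail_deriv L)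
    ((L ^+ 2 - t ^+ 2) / (2 * t ^+ 2) + (L + t)^-1 - 3 / (2 * t)).
Proof.
move=> L0 t0; rewrite /log_tail_deriv.
have Lt0 : 0 < L + t by rewrite ltr_wpDl.
have t20 : 2 * t != 0 by rewrite mulf_neq0 ?pnatr_eq0// gt_eqF.
have dln : is_derive t 1 (fun x : R => ln (L + x)) (L + t)^-1.
  rewrite -[_^-1]mulr1; apply: (@is_derive1_comp _ (@ln R) (fun x => L + x)).
    exact: is_derive1_ln.
  by apply: is_derive_eq; rewrite add0r mulr1.
have dln' := is_derive1_ln t0.
have dV : is_derive t 1 (fun x : R => (2 * x)^-1) (- (2 * t) ^- 2 *: 2).
  have d2 : is_derive t 1 (fun x : R => 2 * x) 2.
    by apply: is_derive_eq; rewrite /GRing.scale/=; ring.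
  exact: is_deriveV.
apply: is_derive_eq; rewrite /GRing.scale/=; field.
by rewrite (gt_eqF t0) (gt_eqF Lt0).
Qed.

Lemma log_tail_deriv_nondecreasing L x y :
  0 < x -> x <= y -> y <= L - 1 -> log_tail_deriv L x <= log_tail_deriv L y.
Proof.
move=> x0 xy yL.
have L0 : 0 <= L by lra.
have dh t (xt : x <= t) := is_derive_log_tail_deriv L0 (lt_le_trans x0 xt).
refine (ger0_derive1_ndecr (a := x) (b := y) _ _ _ (lexx x) xy (lexx y)).
- by move=> t; rewrite in_itv/= => /andP[/ltW/dh[]].
- move=> t; rewrite in_itv/= => /andP[xt ty].
  have t0 : 0 < t by lra.
  have Lt0 : 0 < L + t by lra.
  rewrite derive1E; have [_ ->] := dh _ (ltW xt).
  (* Over the common denominator, substituting [L = t + s] turns the numerator into a sum of three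
     terms, each nonnegative once [1 <= s]; this is what fixes the threshold [L - 1]. *)
  pose s := L - t; have s1 : 1 <= s by rewrite /s; lra.
  rewrite (_ : _ + _ - _ = (4 * t ^+ 2 * (s - 1) + t * s * (4 * s - 3) + s ^+ 3) /
    (2 * t ^+ 2 * (L + t))); last first.
    by rewrite /s; field; rewrite (gt_eqF t0) (gt_eqF Lt0).
  apply: divr_ge0; last by rewrite !mulr_ge0//; lra.
  by rewrite !addr_ge0 ?mulr_ge0 ?exprn_ge0//; lra.
- by apply: derivable_within_continuous => t; rewrite in_itv/= => /andP[/dh[]].
Qed.

End log_density.

(** * The log-density at points symmetric about [c = L - 1] *)

Section log_density_reflection.
Context {R : realType}.
Implicit Types c r : R.

(** The sum of the slopes at [c + r] and [c - r] is even in [r], so it becomes a rational function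
    of [u = r ^+ 2], which lies in [0, 1]. *)
Lemma log_tail_deriv_reflection_slope c r : 1 <= c -> 0 < r -> r <= 1 -> r < c ->
  0 <= (((c + 1) ^+ 2 - (c + r) ^+ 2) / (2 * (c + r) ^+ 2) + (c + 1 + (c + r))^-1
        - 3 / (2 * (c + r))) +
       (((c + 1) ^+ 2 - (c - r) ^+ 2) / (2 * (c - r) ^+ 2) + (c + 1 + (c - r))^-1
        - 3 / (2 * (c - r))).
Proof.
move=> c1 r0 r1 rc.
have p1 : c + r != 0 by rewrite gt_eqF//; lra.
have p2 : c - r != 0 by rewrite gt_eqF//; lra.
have p3 : c + 1 + (c + r) != 0 by rewrite gt_eqF//; lra.
have p4 : c + 1 + (c - r) != 0 by rewrite gt_eqF//; lra.
have p5 : 2 * c + 1 != 0 by rewrite gt_eqF//; lra.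
have p6 : (c + r) * (c - r) != 0 by rewrite mulf_neq0.
have p7 : (c + 1 + (c + r)) * (c + 1 + (c - r)) != 0 by rewrite mulf_neq0.
have u0 : 0 <= r ^+ 2 by exact: sqr_ge0.
have u1 : r ^+ 2 <= 1 by rewrite expr_le1// ltW.
set u := r ^+ 2 in u0 u1.
pose X := c ^+ 2 * (c + 1) + u * (6 * c ^+ 3 + 9 * c ^+ 2 + 5 * c + 2)
  + u * (1 - u) * (2 * c - 1).
(* The two reciprocals add up to [2 / (2 * c + 1)] plus the second fraction; the first fraction
   collects that constant and all remaining terms. Every summand of [X] is nonnegative for [1 <= c]
   and [0 <= u <= 1]. *)
rewrite (_ : _ + _ = X / ((c + r) ^+ 2 * (c - r) ^+ 2 * (2 * c + 1)) +
   2 * u / ((c + 1 + (c + r)) * (c + 1 + (c - r)) * (2 * c + 1))); last first.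
  rewrite /X /u; field.
  by rewrite p1 p2 p3 p4 p5.
have c0 : 0 <= c by lra.
apply: addr_ge0; apply: divr_ge0; rewrite ?mulr_ge0 ?sqr_ge0//; try lra.
have q1 : 0 <= u * (1 - u) * (2 * c - 1) by rewrite !mulr_ge0//; lra.
have q2 : 0 <= c ^+ 2 * (c + 1) by rewrite mulr_ge0 ?sqr_ge0//; lra.
have q3 : 0 <= u * (6 * c ^+ 3 + 9 * c ^+ 2 + 5 * c + 2).
  by rewrite mulr_ge0// !addr_ge0 ?mulr_ge0 ?exprn_ge0.
by rewrite /X; lra.
Qed.

(** The difference [f] of the two values vanishes at 0. Reflection flips the sign of the slope on
    the left, so the derivative of [f] is the sum of slopes bounded above; [r < c] keeps [c - x]
    positive. *)
Lemma log_tail_deriv_reflection c r : 1 <= c -> 0 <= r -> r <= 1 -> r < c ->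
  log_tail_deriv (c + 1) (c - r) <= log_tail_deriv (c + 1) (c + r).
Proof.
move=> c1 r0 r1 rc.
have L0 : 0 <= c + 1 by lra.
pose f x := log_tail_deriv (c + 1) (c + x) - log_tail_deriv (c + 1) (c - x).
suff : f 0 <= f r by rewrite /f addr0 subr0 subrr subr_ge0.
pose g t := ((c + 1) ^+ 2 - t ^+ 2) / (2 * t ^+ 2) + (c + 1 + t)^-1 - 3 / (2 * t).
have df x : 0 <= x -> x <= r -> is_derive x 1 f (g (c + x) + g (c - x)).
  move=> x0 xr.
  have h1 : 0 < c + x by lra.
  have h2 : 0 < c - x by lra.
  have d1 : is_derive x 1 (log_tail_deriv (c + 1) \o (fun x => c + x)) (g (c + x) * 1).
    apply: is_derive1_comp; first exact: is_derive_log_tail_deriv.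
    by apply: is_derive_eq; rewrite add0r mul1r.
  have d2 : is_derive x 1 (log_tail_deriv (c + 1) \o (fun x => c - x)) (g (c - x) * -1).
    apply: is_derive1_comp; first exact: is_derive_log_tail_deriv.
    by apply: is_derive_eq; rewrite add0r mul1r.
  have -> : g (c + x) + g (c - x) = g (c + x) * 1 - g (c - x) * -1 by ring.
  exact: is_deriveB.
refine (ger0_derive1_ndecr (a := 0) (b := r) _ _ _ (lexx 0) r0 (lexx r)).
- by move=> t; rewrite in_itv/= => /andP[/ltW t0 /ltW tr]; have [] := df _ t0 tr.
- move=> t; rewrite in_itv/= => /andP[t0 tr].
  rewrite derive1E; have [_ ->] := df _ (ltW t0) (ltW tr).
  by apply: log_tail_deriv_reflection_slope => //; lra.
- apply: derivable_within_continuous => t; rewrite in_itv/= => /andP[t0 tr].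
  by have [] := df _ t0 tr.
Qed.

End log_density_reflection.

(** * The standard normal tail, and normal tails reduced to it *)

Section standard_normal_tail.
Context {R : realType}.
Implicit Types m s x z : R.

Definition std_tail z : R := fine (normal_prob 0 1 `]z, +oo[).

(** The tail is [1 - F], and the fundamental theorem of calculus applies to [F], an integral from
    minus infinity. *)
Lemma is_derive_std_tail z : is_derive z 1 std_tail (- normal_pdf 0 1 z).
Proof.
pose F x := (\int[lebesgue_measure]_(t in [set` `]-oo, x]]) normal_pdf 0 1 t)%R.
have -> : std_tail = fun x => 1 - F x.
  apply/funext => x; rewrite /std_tail -setCitvl.
  rewrite (@probability_setC _ _ _ (normal_prob 0 1))//.
  by rewrite fineB// fin_num_measure.
have [dF dFE] : derivable F z 1 /\ F^`()%classic z = normal_pdf 0 1 z.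
  apply: (@continuous_FTC1 _ (normal_pdf 0 1) (BInfty _ true) z (z + 1)).
  - by rewrite ltrDl.
  - apply: integrableS (integrable_normal_pdf 0 1) => //.
  - by rewrite ltNyr.
  - by apply: continuous_normal_pdf; rewrite oner_neq0.
have {}dFE : is_derive z 1 F (normal_pdf 0 1 z).
  by rewrite -dFE derive1E; exact/derivableP.
by rewrite -sub0r; apply: is_deriveB; exact: is_derive_cst.
Qed.

(** The identity, seen as a random variable under the standard normal law, has [std_tail] as its
    complementary distribution function; the limit at infinity is then that of a [ccdf]. *)
Let idTR : measurableTypeR R -> R := idfun.

#[local] HB.instance Definition _ :=
  @isMeasurableFun.Build _ _ _ _ idTR (@measurable_id _ _ setT).

Lemma cvg_std_tail : std_tail z @[z --> +oo] --> (0 : R).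
Proof.
have := @cvg_ccdfy0 _ _ _ (normal_prob 0 1) (idTR : {RV (normal_prob 0 1) >-> R}).
move=> /fine_cvg; apply: cvg_trans; apply: near_eq_cvg; near=> z.
by rewrite /std_tail /= /ccdf /distribution /pushforward preimage_id.
Unshelve. all: by end_near. Qed.

Lemma normal_prob_tail m s x : 0 < s ->
  normal_prob m s `]x, +oo[ = (std_tail ((x - m) / s))%:E.
Proof.
move=> s0; have s0' : s != 0 by rewrite gt_eqF.
rewrite /std_tail fineK; last exact: (@fin_num_measure _ _ _ (normal_prob 0 1)).
rewrite /normal_prob.
(* Adding the endpoint changes neither integral and gives the closed half-lines on which the
   substitution [F y = s * y + m] is made. *)
rewrite !integral_itv_obnd_cbnd; last 2 first.
- by apply/measurable_EFinP/measurable_funTS; exact: measurable_normal_pdf.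
- by apply/measurable_EFinP/measurable_funTS; exact: measurable_normal_pdf.
pose F y := s * y + m.
have dF (y : R) : is_derive y 1 F s.
  by rewrite /F; apply: is_derive_eq; rewrite /GRing.scale/= addr0 mulr1.
have dFE : F^`()%classic = cst s.
  by apply/funext => y; rewrite derive1E; have [_ ->] := dF y.
have Fx : F ((x - m) / s) = x by rewrite /F mulrC divfK// subrK.
rewrite -{1}Fx (@increasing_ge0_integration_by_substitutiony _ F (normal_pdf m s)).
- apply: eq_integral => y _; congr EFin.
  rewrite /= !fctE dFE !normal_pdfE ?oner_neq0//= /normal_peak /normal_fun /F.
  rewrite subr0 addrK !expr1n mul1r.
  have -> : s ^+ 2 * pi *+ 2 = s ^+ 2 * (pi *+ 2) by rewrite -mulrnAr.
  rewrite sqrtrM ?sqr_ge0// sqrtr_sqr gtr0_norm// invfM.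
  have -> : - (s * y) ^+ 2 / (s ^+ 2 *+ 2) = - y ^+ 2 / 2.
    by field.
  by rewrite mulrAC (mulrC s^-1) divfK.
- by move=> y z _ _ yz; rewrite /F ltrD2r ltr_pM2l.
- by rewrite dFE => y _; exact: cvg_cst.
- by rewrite dFE; exact: is_cvg_cst.
- by rewrite dFE; exact: is_cvg_cst.
- split=> [y _|]; first by have [] := dF y.
  apply: cvg_at_right_filter; apply: differentiable_continuous.
  by apply/derivable1_diffP; have [] := dF ((x - m) / s).
- rewrite /F; apply: (cvg_comp (fun y : R => s * y) (fun y => y + m)) (cvg_addrr m).
  by apply: gt0_cvgMry => //; exact: cvg_id.
- by apply: continuous_subspaceT; exact: continuous_normal_pdf.
- by move=> y _; exact: normal_pdf_ge0.
Qed.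
End standard_normal_tail.

(** * Regularity of the tail when mean and variance coincide *)

Section scaled_tail.
Context {R : realType}.
Implicit Types L t x y : R.

(* The probability that a normal variable of mean and variance [t] exceeds
   [L]; for [L > 0], the value [0] at [t <= 0] makes it continuous. *)
Definition scaled_tail L t : R :=
  if t <= 0 then 0 else std_tail ((L - t) / Num.sqrt t).

(** Chain rule through [(L - t) / Num.sqrt t]: the normal density supplies the quadratic term of
    [log_tail_deriv], and the inner derivative supplies the logarithms of [L + t] and of [t] to the
    power 3/2. *)
Lemma is_derive_scaled_tail L t : 0 <= L -> 0 < t ->
  is_derive t 1 (scaled_tail L)
    (normal_peak 1 / 2 * expR (log_tail_deriv L t)).
Proof.
move=> L0 t0.
have Lt0 : 0 < L + t by lra.
have s0 : 0 < Num.sqrt t by rewrite sqrtr_gt0.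
have s0' : Num.sqrt t != 0 by rewrite gt_eqF.
have ds := is_derive1_sqrt t0.
have dV : is_derive t 1 (fun x : R => (Num.sqrt x)^-1)
    (- (Num.sqrt t) ^- 2 *: (2 * Num.sqrt t)^-1) by exact: is_deriveV.
have dz : is_derive t 1 (fun x : R => (L - x) / Num.sqrt x)
    (- (L + t) / (2 * t * Num.sqrt t)).
  apply: is_derive_eq; rewrite /GRing.scale/=.
  (* Writing [t] as the square of its root makes the identity rational in [Num.sqrt t]. *)
  rewrite -[in RHS](sqr_sqrtr (ltW t0)) -[in LHS](sqr_sqrtr (ltW t0)).
  rewrite ![Num.sqrt (_ ^+ 2)]sqrtr_sqr !ger0_norm ?sqrtr_ge0//.
  by field.
have -> : normal_peak 1 / 2 * expR (log_tail_deriv L t) =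
    - normal_pdf 0 1 ((L - t) / Num.sqrt t) * (- (L + t) / (2 * t * Num.sqrt t)).
  rewrite normal_pdfE ?oner_neq0// /log_tail_deriv !expRD lnK ?posrE//.
  rewrite /normal_fun subr0 expr1n exprMn exprVn sqr_sqrtr ?ltW//.
  have -> : expR (- (3 / 2 * ln t)) = (t * Num.sqrt t)^-1.
    have es : Num.sqrt t = expR (ln t / 2).
      rewrite -{1}(lnK t0) (_ : expR (ln t) = expR (ln t / 2) ^+ 2); last first.
        by rewrite expr2 -expRD; congr expR; field.
      by rewrite sqrtr_sqr ger0_norm ?expR_ge0.
    by rewrite -{2}(lnK t0) es -expRD -expRN; congr expR; field.
  have -> : - ((L - t) ^+ 2 / (2 * t)) = - ((L - t) ^+ 2 / t) / 2.
    by field; rewrite gt_eqF.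
  field.
  by rewrite (gt_eqF s0) (gt_eqF t0).
have := @is_derive1_comp _ std_tail _ t _ _ (is_derive_std_tail _) dz.
apply: near_eq_is_derive; near=> x.
by rewrite /scaled_tail leNgt ifF//; apply/negbF; near: x; exact: lt_nbhsr.
Unshelve. all: by end_near. Qed.

Lemma continuous_scaled_tail L : 0 < L -> continuous (scaled_tail L).
Proof.
move=> L0 t; have [t0|t0|->] := ltgtP t 0.
- rewrite /continuous_at {2}/scaled_tail ltW//.
  apply: cvg_near_cst; near=> x.
  by rewrite /scaled_tail ifT// ltW//; near: x; exact: lt_nbhsl.
- apply: differentiable_continuous; apply/derivable1_diffP.
  by have [] := is_derive_scaled_tail (ltW L0) t0.
- rewrite /continuous_at {2}/scaled_tail lexx.
  apply/cvgrPdist_lt => e e0.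
  have [M [Mreal HM]] : \forall z \near +oo, `|0 - std_tail z| < e.
    by move/cvgrPdist_lt : (@cvg_std_tail R); exact.
  (* [M] may be nonpositive, so it is replaced by [N], by which one can divide. For small positive
     [x], [M * Num.sqrt x <= N * Num.sqrt x < L / 2 < L - x], so the argument of [std_tail] exceeds
     [M]. *)
  pose N := Num.max M 1.
  have N0 : 0 < N by rewrite lt_max ltr01 orbT.
  near=> x; rewrite /scaled_tail; case: ifPn => [_|]; first by rewrite subrr normr0.
  rewrite -ltNge => x0.
  have xL : x < L / 2 by near: x; apply: lt_nbhsl; rewrite divr_gt0.
  have xN : x < (L / (2 * N)) ^+ 2.
    by near: x; apply: lt_nbhsl; rewrite exprn_gt0// divr_gt0// mulr_gt0.
  have sx0 : 0 < Num.sqrt x by rewrite sqrtr_gt0.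
  apply: HM; rewrite ltr_pdivlMr//.
  have xN' : Num.sqrt x < L / (2 * N).
    rewrite -[ltRHS]ger0_norm ?divr_ge0 ?mulr_ge0 ?ltW//.
    by rewrite -sqrtr_sqr ltr_sqrt// exprn_gt0// divr_gt0// mulr_gt0.
  have h1 : M * Num.sqrt x <= N * Num.sqrt x.
    by rewrite ler_pM2r// le_max lexx.
  have h2 : N * Num.sqrt x < L / 2.
    rewrite -(ltr_pM2l N0) in xN'; apply: (lt_le_trans xN').
    by rewrite le_eqVlt; apply/orP; left; apply/eqP; field; rewrite gt_eqF.
  lra.
Unshelve. all: by end_near. Qed.

End scaled_tail.

(** * Supermodularity of the tail *)

Section scaled_tail_supermodular.
Context {R : realType}.
Implicit Types L a b c d m r x y : R.

(** This is convexity on [0, L - 1], from the monotone derivative. At [x = 0] only continuity is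
    available, so derivatives are taken at [e > 0]. *)
Lemma scaled_tail_increment_le L x y d : 0 <= x -> x <= y -> 0 <= d ->
  y + d <= L - 1 ->
  scaled_tail L (x + d) - scaled_tail L x <=
  scaled_tail L (y + d) - scaled_tail L y.
Proof.
move=> x0 xy d0 yd.
have L0 : 0 < L by lra.
pose f e := scaled_tail L (y + e) - scaled_tail L (x + e).
suff : f 0 <= f d by rewrite /f !addr0; move: (scaled_tail L) => H; lra.
pose h t := normal_peak 1 / 2 * expR (log_tail_deriv L t).
have dH z (e : R) : 0 <= z -> 0 < e ->
    is_derive e 1 (scaled_tail L \o (fun e => z + e)) (h (z + e) * 1).
  move=> z0 e0; apply: is_derive1_comp.
    by apply: is_derive_scaled_tail; [exact: ltW|rewrite ltr_wpDl].
  by apply: is_derive_eq; rewrite add0r mul1r.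
have df (e : R) : 0 < e -> is_derive e 1 f (h (y + e) - h (x + e)).
  move=> e0; rewrite -[h (y + e)]mulr1 -[h (x + e)]mulr1.
  by apply: is_deriveB; apply: dH => //; exact: le_trans xy.
have cH z : continuous (scaled_tail L \o (fun e => z + e)).
  move=> e; apply: continuous_comp; last exact: continuous_scaled_tail.
  by apply: cvgD; [exact: cvg_cst|exact: cvg_id].
refine (ger0_derive1_ndecr (a := 0) (b := d) _ _ _ (lexx 0) d0 (lexx d)).
- by move=> e; rewrite in_itv/= => /andP[e0 _]; have [] := df _ e0.
- move=> e; rewrite in_itv/= => /andP[e0 ed].
  rewrite derive1E; have [_ ->] := df _ e0.
  rewrite subr_ge0 /h ler_pM2l ?divr_gt0 ?normal_peak_gt0 ?oner_neq0//.
  by rewrite ler_expR; apply: log_tail_deriv_nondecreasing; lra.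
- by apply: continuous_subspaceT => e; apply: cvgB; exact: cH.
Qed.

(** The symmetric sum [f] has derivative [h (c + e) - h (c - e)], nonnegative by reflection of the
    log-density. The case [r = c = 1] is covered: only [e < r] is differentiated, and continuity
    reaches the endpoint 0. *)
Lemma scaled_tail_reflection c r : 1 <= c -> 0 <= r -> r <= 1 ->
  scaled_tail (c + 1) c - scaled_tail (c + 1) (c - r) <=
  scaled_tail (c + 1) (c + r) - scaled_tail (c + 1) c.
Proof.
move=> c1 r0 r1.
have L0 : 0 < c + 1 by lra.
pose f e := scaled_tail (c + 1) (c + e) + scaled_tail (c + 1) (c - e).
suff : f 0 <= f r by rewrite /f addr0 subr0; move: (scaled_tail _) => H; lra.
pose h t := normal_peak 1 / 2 * expR (log_tail_deriv (c + 1) t).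
have df (e : R) : 0 < e -> e < r -> is_derive e 1 f (h (c + e) - h (c - e)).
  move=> e0 er; rewrite -[h (c + e)]mulr1 -[- h (c - e)]mulrN1.
  apply: is_deriveD.
    apply: (@is_derive1_comp _ (scaled_tail (c + 1)) (fun e => c + e)).
      by apply: is_derive_scaled_tail; lra.
    by apply: is_derive_eq; rewrite add0r mul1r.
  apply: (@is_derive1_comp _ (scaled_tail (c + 1)) (fun e => c - e)).
    by apply: is_derive_scaled_tail; lra.
  by apply: is_derive_eq; rewrite add0r mul1r.
refine (ger0_derive1_ndecr (a := 0) (b := r) _ _ _ (lexx 0) r0 (lexx r)).
- by move=> e; rewrite in_itv/= => /andP[e0 er]; have [] := df _ e0 er.
- move=> e; rewrite in_itv/= => /andP[e0 er].
  rewrite derive1E; have [_ ->] := df _ e0 er.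
  rewrite subr_ge0 /h ler_pM2l ?divr_gt0 ?normal_peak_gt0 ?oner_neq0//.
  by rewrite ler_expR; apply: log_tail_deriv_reflection; lra.
- apply: continuous_subspaceT => e; apply: cvgD.
    apply: (@continuous_comp _ _ _ (fun e => c + e)); last exact: continuous_scaled_tail.
    by apply: cvgD; [exact: cvg_cst|exact: cvg_id].
  apply: (@continuous_comp _ _ _ (fun e => c - e)); last exact: continuous_scaled_tail.
  by apply: cvgB; [exact: cvg_cst|exact: cvg_id].
Qed.

Lemma scaled_tail_supermodular L m a b : 0 <= m -> 1 <= a -> 1 <= b ->
  m + a + b <= L ->
  scaled_tail L (m + a) - scaled_tail L m <=
  scaled_tail L (m + a + b) - scaled_tail L (m + b).
Proof.
move=> m0 a1 b1 mabL.
have [le|lt] := leP (m + a + b) (L - 1).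
  by rewrite (addrAC m); apply: scaled_tail_increment_le; lra.
have [c cE] : exists c, c = L - 1 by exists (L - 1).
have [r rE] : exists r, r = m + a + b - c by exists (m + a + b - c).
have cL : L = c + 1 by rewrite cE subrK.
have c1 : 1 <= c by lra.
have r0 : 0 <= r by lra.
have r1 : r <= 1 by lra.
have := scaled_tail_reflection c1 r0 r1; rewrite -cL.
(* The increment over [a] is cut at [r <= 1 <= a]. Its first piece is moved to end at [c] and then
   reflected across [c]; the second is shifted to run from [m + b] to [c]. The conditions [1 <= a]
   and [1 <= b] make both moves go to the right. *)
have : scaled_tail L (m + r) - scaled_tail L m <=
       scaled_tail L (c - r + r) - scaled_tail L (c - r).
  by apply: scaled_tail_increment_le; lra.
have : scaled_tail L (m + r + (a - r)) - scaled_tail L (m + r) <=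
       scaled_tail L (m + b + (a - r)) - scaled_tail L (m + b).
  by apply: scaled_tail_increment_le; lra.
have -> : m + r + (a - r) = m + a by ring.
have -> : m + b + (a - r) = c by rewrite rE; ring.
have -> : c + r = m + a + b by rewrite rE; ring.
have -> : c - r + r = c by ring.
move: (scaled_tail L) => H h1 h2 h3.
lra.
Qed.

End scaled_tail_supermodular.

(** * Translation and convolution of normal laws *)

Section normal_measures.
Context {R : realType}.
Implicit Types m s t x y z : R.
Local Notation leb := (@lebesgue_measure R).

(** The Radon-Nikodym derivative and [normal_pdf] have the same integral over every measurable set,
    hence agree almost everywhere. *)
Lemma ge0_integral_normal_prob m s (f : measurableTypeR R -> \bar R) :
  measurable_fun setT f -> (forall x, (0 <= f x)%E) ->
  (\int[normal_prob m s]_x f x = \int[leb]_x (f x * (normal_pdf m s x)%:E))%E.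
Proof.
move=> mf f0.
have dom : normal_prob m s `<< leb by exact: normal_prob_dominates.
rewrite -(Radon_Nikodym_SigmaFinite.change_of_variables dom)//.
have intRN := Radon_Nikodym_SigmaFinite.f_integrable dom.
apply: ae_eq_integral => //.
- by apply: emeasurable_funM => //; exact: measurable_int intRN.
- by apply: emeasurable_funM => //; apply/measurable_EFinP; exact: measurable_normal_pdf.
- apply: ae_eqe_mul2l; apply: integral_ae_eq => //.
  + by apply/measurable_EFinP; exact: measurable_normal_pdf.
  + by move=> E _ mE; rewrite -Radon_Nikodym_SigmaFinite.f_integral.
Qed.

Lemma measurable_shift x :
  measurable_fun setT (fun y : measurableTypeR R => x + y : measurableTypeR R).
Proof. by apply: measurable_funD => //; exact: measurable_id. Qed.

(** By uniqueness it suffices to compare the pushforward with Lebesgue measure on half-open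
    intervals. *)
Lemma lebesgue_measure_shift x (A : set R) : measurable A ->
  leb ((fun y => x + y) @^-1` A) = leb A.
Proof.
move=> mA.
pose phi := HB.pack_for {mfun measurableTypeR R >-> measurableTypeR R}
  (fun y : measurableTypeR R => x + y : measurableTypeR R)
  (isMeasurableFun.Build _ _ _ _ _ (measurable_shift x)).
apply/esym/(@lebesgue_measure_unique R (pushforward leb phi)) => //= _ [[a b]] _ <-.
rewrite /pushforward (_ : _ @^-1` _ = `](a - x), (b - x)]%classic); last first.
  by apply/seteqP; split=> y /=; rewrite !in_itv/= ltrBlDl lerBrDl.
by rewrite /= !lebesgue_measure_itv/= !lte_fin ltrD2r; case: ifPn => // _; congr EFin; ring.
Qed.


Lemma normal_prob_shift m s x (A : set R) : s != 0 -> measurable A ->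
  normal_prob m s ((fun y => x + y) @^-1` A) = normal_prob (x + m) s A.
Proof.
move=> s0 mA; rewrite /normal_prob.
pose phi := HB.pack_for {mfun measurableTypeR R >-> measurableTypeR R}
  (fun y : measurableTypeR R => x + y : measurableTypeR R)
  (isMeasurableFun.Build _ _ _ _ _ (measurable_shift x)).
transitivity (\int[pushforward leb phi]_(z in A) (normal_pdf (x + m) s z)%:E)%E.
  rewrite ge0_integral_pushforward//.
  - apply: eq_integral => y _; rewrite /= !normal_pdfE// /normal_fun.
    by have -> : x + y - (x + m) = y - m by ring.
  - by apply/measurable_EFinP/measurable_funTS; exact: measurable_normal_pdf.
  - by move=> y _; rewrite lee_fin normal_pdf_ge0.
by apply: eq_measure_integral => B mB _; exact: lebesgue_measure_shift.
Qed.

Lemma normal_peakE s : 0 < s ->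
  normal_peak s = s^-1 * (Num.sqrt (pi *+ 2))^-1.
Proof.
move=> s0; rewrite /normal_peak -mulrnAr sqrtrM ?sqr_ge0// sqrtr_sqr.
by rewrite gtr0_norm// invfM.
Qed.

(* Completing the square: the joint density of (X, X + Y) factors into the
   density of X + Y and the conditional density of X, again a normal one. *)
Lemma normal_pdf_factor m1 m2 s1 s2 s x z : 0 < s1 -> 0 < s2 -> 0 < s ->
  s ^+ 2 = s1 ^+ 2 + s2 ^+ 2 ->
  normal_pdf (x + m2) s2 z * normal_pdf m1 s1 x =
  normal_pdf (m1 + m2) s z *
  normal_pdf ((m1 * s2 ^+ 2 + (z - m2) * s1 ^+ 2) / s ^+ 2) (s1 * s2 / s) x.
Proof.
move=> s1_gt0 s2_gt0 s_gt0 sE.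
have n1 : s1 != 0 by rewrite gt_eqF.
have n2 : s2 != 0 by rewrite gt_eqF.
have n : s != 0 by rewrite gt_eqF.
have n12 : s1 ^+ 2 + s2 ^+ 2 != 0 by rewrite -sE expf_neq0.
rewrite !normal_pdfE ?mulf_neq0 ?invr_eq0// /normal_fun.
rewrite !normal_peakE ?divr_gt0 ?mulr_gt0//.
rewrite ![_ * expR _ * _]mulrACA -!expRD; congr (_ * expR _).
  by rewrite !invfM invrK; set P := (Num.sqrt _)^-1; field; rewrite n1 n2 n.
rewrite !expr_div_n !exprMn sE; field.
by rewrite n1 n2 n12.
Qed.


Lemma measurable_normal_pdf_mean m s : s != 0 ->
  measurable_fun setT (fun p : measurableTypeR R * measurableTypeR R =>
    normal_pdf (p.1 + m) s p.2).
Proof.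
move=> s0; under eq_fun do rewrite normal_pdfE//.
apply: measurable_funM => //; apply: measurableT_comp => //=.
apply: measurable_funM => //; apply: measurableT_comp => //=.
apply: measurable_funX => //; apply: measurable_funB => //.
by apply: measurable_funD => //.
Qed.

Lemma measurable_preimage_add (A : set R) : measurable A ->
  measurable [set p : measurableTypeR R * measurableTypeR R | A (p.1 + p.2)].
Proof.
move=> mA; rewrite -[X in measurable X]setTI.
have /= := @measurable_funD _ (measurableTypeR R * measurableTypeR R)%type R setT
  (fst : _ -> measurableTypeR R) snd.
by apply => //.
Qed.

(** The section at [x] is a translate of [A], whose measure has density [normal_pdf (x + m2) s2] in
    the value [z] of the sum. After Tonelli and the factorization, the conditional density
    integrates to 1 over [x]. *)
Lemma normal_prob_add m1 m2 s1 s2 s (A : set R) : 0 < s1 -> 0 < s2 -> 0 < s ->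
  s ^+ 2 = s1 ^+ 2 + s2 ^+ 2 -> measurable A ->
  (normal_prob m1 s1 \x normal_prob m2 s2)%E [set p | A (p.1 + p.2)] =
  normal_prob (m1 + m2) s A.
Proof.
move=> s1_gt0 s2_gt0 s_gt0 sE mA.
have n2 : s2 != 0 by rewrite gt_eqF.
pose f (p : measurableTypeR R * measurableTypeR R) : \bar R :=
  (normal_pdf (p.1 + m2) s2 p.2 * \1_A p.2)%:E.
have f0 p : (0 <= f p)%E by rewrite lee_fin mulr_ge0 ?normal_pdf_ge0.
have mf : measurable_fun setT f.
  apply/measurable_EFinP; apply: measurable_funM; first exact: measurable_normal_pdf_mean.
  by apply: measurableT_comp => //; exact: measurable_indic.
transitivity (\int[normal_prob m1 s1]_x \int[leb]_z f (x, z))%E.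
  rewrite /product_measure1; apply: eq_integral => x _ /=.
  rewrite (_ : xsection _ _ = (fun y => x + y) @^-1` A); last first.
    by apply/seteqP; split=> y; rewrite /xsection/= inE.
  rewrite normal_prob_shift// /normal_prob integral_mkcond.
  apply: eq_integral => z _; rewrite /f/= patchE indicE.
  by case: ifPn => _; rewrite ?mulr1 ?mulr0.
rewrite (@fubini_tonelli _ _ _ _ _ (normal_prob m1 s1) leb f)//.
rewrite [RHS]/normal_prob [RHS]integral_mkcond.
apply: eq_integral => z _.
rewrite ge0_integral_normal_prob//; last first.
  by apply: measurableT_comp => //; exact: measurable_pair2.
rewrite patchE; case: ifPn => zA; last first.
  apply: integral0_eq => x _; rewrite /f/= indicE (negbTE zA).
  by rewrite mulr0 mul0e.
under eq_integral => x _.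
  rewrite /f/= indicE zA mulr1 -EFinM (normal_pdf_factor m1 m2 x z s1_gt0 s2_gt0 s_gt0 sE).
  rewrite EFinM; over.
rewrite ge0_integralZl//=.
- by rewrite integral_normal_pdf mule1.
- by apply/measurable_EFinP; exact: measurable_normal_pdf.
- by move=> x _; rewrite lee_fin normal_pdf_ge0.
- by rewrite lee_fin normal_pdf_ge0.
Qed.

End normal_measures.

(** * Joint laws determined by rectangles *)

Section independence.
Context d (T : measurableType d) (R : realType) (P : probability T R).

(** Rectangles form a generating family stable under intersection, on which the two finite measures
    [m1] and [m2] agree. The extra event [G] lets further independent constraints be carried
    along. *)
Lemma product_law_of_rectangles (X Y : T -> measurableTypeR R) (G : set T)
    (mu nu : probability (measurableTypeR R) R) :
  measurable_fun setT X -> measurable_fun setT Y -> measurable G ->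
  (forall A C, measurable A -> measurable C ->
    P (X @^-1` A `&` Y @^-1` C `&` G) = (mu A * nu C * P G)%E) ->
  forall E, measurable E ->
    P ((fun w => (X w, Y w)) @^-1` E `&` G) = ((mu \x nu)%E E * P G)%E.
Proof.
move=> mX mY mG rect E mE.
have mXY : measurable_fun setT (fun w => (X w, Y w)) by exact: measurable_fun_pair.
pose phi := HB.pack_for {mfun T >-> (measurableTypeR R * measurableTypeR R)%type}
  (fun w => (X w, Y w)) (isMeasurableFun.Build _ _ _ _ _ mXY).
have r0 : 0 <= fine (P G) by rewrite fine_ge0.
have PG : P G = (fine (P G))%:E by rewrite fineK// fin_num_measure.
pose m1 := pushforward (mrestr P mG) phi.
pose m2 := mscale (NngNum r0) (mu \x nu)%E.
suff : m1 E = m2 E by rewrite /m1 /m2 /mscale/= -PG muleC.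
pose C : set (set (measurableTypeR R * measurableTypeR R)) :=
  [set A `*` B | A in measurable & B in measurable].
apply: (measure_unique C (fun=> setT)) => //.
- exact: measurable_prod_measurableType.
- move=> _ _ [A mA [B mB <-]] [A' mA' [B' mB' <-]].
  exists (A `&` A'); first exact: measurableI.
  by exists (B `&` B'); [exact: measurableI|rewrite setXI].
- by move=> _; exists setT => //; exists setT => //; rewrite setXTT.
- by rewrite bigcup_const.
- move=> _ [A mA [B mB <-]].
  transitivity (P (X @^-1` A `&` Y @^-1` B `&` G)); first by [].
  by rewrite rect// -product_measure1E// muleC {1}PG.
- move=> _; change (P (setT `&` G) < +oo)%E; rewrite setTI.
  by rewrite (le_lt_trans (probability_le1 P mG)) ?ltry.
Qed.

End independence.

(** * Laws of sums of independent normal variables *)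

Section independent_normal_sums.
Context d (T : measurableType d) (R : realType) (P : probability T R).
Variables (I : finType) (S : {set I}) (xi : I -> {RV P >-> R}) (m sigma : I -> R).
Hypothesis indep : independent_on S xi.
Hypothesis normal : forall i, i \in S -> has_normal_law (xi i) (m i) (sigma i).
Implicit Types (U J : {set I}) (A : set R) (B : I -> set R).

Let event J B : set T := \bigcap_(i in [set` J]) (xi i @^-1` B i).

Lemma measurable_event J B : (forall i, i \in J -> measurable (B i)) ->
  measurable (event J B).
Proof.
move=> mB; apply: fin_bigcap_measurable => //= i iJ.
by rewrite -[X in measurable X]setTI; apply: measurable_funP => //; exact: mB.
Qed.

Lemma measurable_sum_on U : measurable_fun setT (fun w => \sum_(i in U) xi i w).
Proof.
under eq_fun do rewrite -big_enum.
by apply: measurable_sum => i; exact: measurable_funP.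
Qed.

(** Overwriting the family at [k] absorbs one more constraint, on [xi k], into an [event]. *)
Let updB k C B i := if i == k then C else B i.

Let updBE k C J B i : k \notin J -> i \in J -> updB k C B i = B i.
Proof. by rewrite /updB; case: eqP => // -> /negP. Qed.

Let event_setU1 k J C B : k \notin J ->
  xi k @^-1` C `&` event J B = event (k |: J)%SET (updB k C B).
Proof.
move=> kJ; apply/seteqP; split => [w [wC wJ] i /=|w wkJ].
  rewrite !inE => /orP[/eqP ->|iJ]; first by rewrite /updB eqxx.
  by rewrite (updBE _ _ kJ)//; exact: wJ.
split; first by have := wkJ k; rewrite /= setU11 /updB eqxx; exact.
by move=> i /= iJ; have := wkJ i; rewrite /= (updBE _ _ kJ)// inE iJ orbT; exact.
Qed.

Let measurable_updB k J C B : k \notin J ->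
  measurable C -> (forall i, i \in J -> measurable (B i)) ->
  forall i, i \in (k |: J)%SET -> measurable (updB k C B i).
Proof.
move=> kJ mC mB i; rewrite !inE => /orP[/eqP ->|iJ]; first by rewrite /updB eqxx.
by rewrite (updBE _ _ kJ)//; exact: mB.
Qed.

Lemma independent_normal_event k J C B : k \in S -> J \subset S -> k \notin J ->
  measurable C -> (forall i, i \in J -> measurable (B i)) ->
  P (xi k @^-1` C `&` event J B) = (normal_prob (m k) (sigma k) C * P (event J B))%E.
Proof.
move=> kS JS kJ mC mB; rewrite event_setU1// /event !indep//; last 2 first.
- by rewrite finset.subUset finset.sub1set kS.
- exact: measurable_updB.
rewrite big_setU1//= {1}/updB eqxx -(normal kS).2//; congr (_ * _)%E.
by apply: eq_bigr => i iJ; rewrite (updBE _ _ kJ).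
Qed.

(** Induction on the size of [U], peeling off one variable. Independence from an arbitrary
    [event J B] is part of the claim because the peeled variable becomes a constraint there. [U] is
    nonempty since deviation 0 does not give a point mass in [normal_prob]. *)
Lemma normal_sum_law U J A B : U != finset.set0 -> U \subset S -> J \subset S ->
  (forall i, i \in U -> i \notin J) -> measurable A -> (forall i, i \in J -> measurable (B i)) ->
  P ((fun w => \sum_(i in U) xi i w) @^-1` A `&` event J B) =
  (normal_prob (\sum_(i in U) m i) (Num.sqrt (\sum_(i in U) sigma i ^+ 2)) A
   * P (event J B))%E.
Proof.
have [n] := ubnP #|U|; elim: n U J A B => // n IH U J A B /ltnSE Un U0 US JS UJ mA mB.
have /set0Pn[k kU] := U0.
have kS : k \in S := fintype.subsetP US _ kU.
have kJ : k \notin J := UJ _ kU.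
have sk0 : 0 < sigma k := (normal kS).1.
have UE : U = k |: (U :\ k)%SET by rewrite finset.setD1K.
have kUk : k \notin (U :\ k)%SET by rewrite !inE eqxx.
have UkS : (U :\ k)%SET \subset S by rewrite (fintype.subset_trans _ US)// finset.subsetDl.
have sumE (F : I -> R) : \sum_(i in U) F i = F k + \sum_(i in (U :\ k)%SET) F i.
  by rewrite {1}UE big_setU1.
have [Uk0|Uk0] := eqVneq (U :\ k)%SET finset.set0.
  rewrite !sumE Uk0 !big_set0 !addr0 sqrtr_sqr gtr0_norm//.
  have -> : (fun w => \sum_(i in U) xi i w) = xi k.
    by apply/funext => w; rewrite sumE Uk0 big_set0 addr0.
  exact: independent_normal_event.
have sU0 : 0 < \sum_(i in (U :\ k)%SET) sigma i ^+ 2.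
  have /set0Pn[j jU] := Uk0.
  rewrite (bigD1 j)//= ltr_pwDl ?sumr_ge0//; last by move=> i _; exact: sqr_ge0.
  by rewrite exprn_gt0// (normal (fintype.subsetP UkS _ jU)).1.
set mU := \sum_(i in (U :\ k)%SET) m i.
set sU := Num.sqrt (\sum_(i in (U :\ k)%SET) sigma i ^+ 2).
have prodlaw := @product_law_of_rectangles _ T R P (xi k)
  (fun w => \sum_(i in (U :\ k)%SET) xi i w) (event J B)
  (normal_prob (m k) (sigma k)) (normal_prob mU sU) _ _ (measurable_event mB).
have -> : (fun w => \sum_(i in U) xi i w) @^-1` A =
    (fun w => (xi k w, \sum_(i in (U :\ k)%SET) xi i w)) @^-1` [set p | A (p.1 + p.2)].
  by apply/seteqP; split=> w /=; rewrite sumE.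
rewrite prodlaw.
- rewrite !sumE; congr (_ * _)%E; apply: normal_prob_add => //.
  + by rewrite sqrtr_gt0.
  + by rewrite sqrtr_gt0 addr_gt0// exprn_gt0.
  + by rewrite !sqr_sqrtr ?addr_ge0 ?sqr_ge0// ltW.
- exact: (@measurable_funPT _ _ _ _ (xi k)).
- exact: measurable_sum_on.
- move=> C A' mC mA'.
  (* On a rectangle, the constraint on [xi k] joins the event, the induction hypothesis handles the
     remaining sum, and independence then takes [xi k] out again. *)
  rewrite -setIA setICA event_setU1// IH//.
  + by rewrite -event_setU1// independent_normal_event// muleA (muleC (normal_prob mU sU _)).
  + by rewrite (leq_trans _ Un)// [X in (_ < X)%N](cardsD1 k) kU.
  + by rewrite finset.subUset finset.sub1set kS.
  + by move=> i; rewrite !inE negb_or => /andP[-> /UJ].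
  + exact: measurable_updB.
- exact: measurable_preimage_add.
Qed.

Lemma normal_sum_law1 U A : U != finset.set0 -> U \subset S -> measurable A ->
  P ((fun w => \sum_(i in U) xi i w) @^-1` A) =
  normal_prob (\sum_(i in U) m i) (Num.sqrt (\sum_(i in U) sigma i ^+ 2)) A.
Proof.
move=> U0 US mA.
have := @normal_sum_law U finset.set0 A (fun=> setT) U0 US (finset.sub0set S).
have -> : event finset.set0 (fun=> setT) = setT.
  by apply/seteqP; split=> // w _ i /=; rewrite inE.
by rewrite setIT probability_setT mule1; apply => // i; rewrite inE.
Qed.

Lemma normal_sum_pair_law k U E : U != finset.set0 -> U \subset S -> k \in S ->
  k \notin U -> measurable E ->
  P ((fun w => (xi k w, \sum_(i in U) xi i w)) @^-1` E) =
  (normal_prob (m k) (sigma k) \x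
   normal_prob (\sum_(i in U) m i) (Num.sqrt (\sum_(i in U) sigma i ^+ 2)))%E E.
Proof.
move=> U0 US kS kU mE; rewrite -[_ @^-1` E]setIT -[RHS]mule1 -(probability_setT P).
apply: product_law_of_rectangles => //.
- exact: (@measurable_funPT _ _ _ _ (xi k)).
- exact: measurable_sum_on.
- move=> A C mA mC; rewrite setIT probability_setT mule1 setIC.
  have evE : xi k @^-1` A = event [set k]%SET (fun=> A).
    apply/seteqP; split=> [w wA i|w]; first by rewrite /= inE => /eqP ->.
    by apply; rewrite /= inE.
  rewrite evE normal_sum_law//.
  + by rewrite -evE muleC; congr (_ * _)%E; exact: (normal kS).2.
  + by rewrite finset.sub1set.
  + by move=> i iU; rewrite inE; apply: contraNneq kU => <-.
Qed.

End independent_normal_sums.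

(** * Comparison of normal laws on the upper tail *)

Section normal_comparison.
Context {R : realType}.
Implicit Types (D L a t s x : R).

(** The ratio of peaks is at most [expR (a / t / 2)], by [1 + u <= expR u] at [u = a / t]. The gain
    in the exponent outweighs this as soon as [x ^+ 2] is at least [(t + D) * (t + a)]. *)
Lemma normal_pdf_le D t a s1 s2 x : 0 < D -> D <= 1 -> 0 < t -> 0 <= a ->
  0 < s1 -> 0 < s2 -> s1 ^+ 2 = D * t -> s2 ^+ 2 = D * (t + a) ->
  t + a + 1 <= x -> normal_pdf t s1 x <= normal_pdf (t + a) s2 x.
Proof.
move=> D0 D1 t0 a0 s10 s20 s1E s2E xL.
have ta0 : 0 < t + a by lra.
have n1 : s1 != 0 by rewrite gt_eqF.
have n2 : s2 != 0 by rewrite gt_eqF.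
rewrite !normal_pdfE// /normal_fun.
rewrite !normal_peakE// -!mulrA ![(Num.sqrt _)^-1 * _]mulrC !mulrA.
rewrite ler_wpM2r ?invr_ge0 ?sqrtr_ge0//.
rewrite ler_pdivrMl// mulrCA ler_pdivlMl//.
have s2le : s2 <= s1 * expR (a / t / 2).
  rewrite -(@ler_pXn2r _ 2) ?nnegrE ?(ltW s20)//; last by rewrite mulr_ge0 ?expR_ge0// ltW.
  rewrite exprMn s1E s2E -expRM_natl -[D * t * _]mulrA ler_pM2l//.
  have -> : t + a = t * (1 + a / t) by field; rewrite gt_eqF.
  rewrite ler_pM2l//; apply: le_trans (expR_ge1Dx _) _.
  by rewrite ler_expR le_eqVlt; apply/orP; left; apply/eqP; field; rewrite gt_eqF.
apply: (le_trans (ler_wpM2r (expR_ge0 _) s2le)).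
rewrite -[s1 * _ * _]mulrA -expRD ler_pM2l// ler_expR s1E s2E -subr_ge0.
have -> : - (x - (t + a)) ^+ 2 / (D * (t + a) *+ 2) -
    (a / t / 2 + - (x - t) ^+ 2 / (D * t *+ 2)) =
    a * (x ^+ 2 - t * (t + a) - D * (t + a)) / (2 * D * t * (t + a)).
  by field; rewrite (gt_eqF t0) (gt_eqF D0) (gt_eqF ta0).
apply: divr_ge0; last by rewrite !mulr_ge0// ltW.
apply: mulr_ge0 => //.
have : (t + a + 1) ^+ 2 <= x ^+ 2 by rewrite ler_pXn2r// nnegrE; lra.
have : D * (t + a) <= t + a by rewrite ler_piMl// ltW.
have : 0 <= (t + a) * a by rewrite mulr_ge0// ltW.
nra.
Qed.

Lemma normal_prob_le D t a s1 s2 L (A : set R) : 0 < D -> D <= 1 -> 0 < t -> 0 <= a ->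
  0 < s1 -> 0 < s2 -> s1 ^+ 2 = D * t -> s2 ^+ 2 = D * (t + a) ->
  t + a + 1 <= L -> measurable A -> A `<=` `]L, +oo[ ->
  (normal_prob t s1 A <= normal_prob (t + a) s2 A)%E.
Proof.
move=> D0 D1 t0 a0 s10 s20 s1E s2E taL mA AL; rewrite /normal_prob.
apply: ge0_le_integral => //.
- by move=> x _; rewrite lee_fin normal_pdf_ge0.
- by apply/measurable_EFinP/measurable_funTS; exact: measurable_normal_pdf.
- by apply/measurable_EFinP/measurable_funTS; exact: measurable_normal_pdf.
- move=> x /AL; rewrite /= in_itv/= andbT => Lx; rewrite lee_fin.
  by apply: normal_pdf_le s1E s2E _ => //; lra.
Qed.

(** Dividing by [D] turns mean [t] and variance [D * t] into a mean and a variance both equal to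
    [t / D]. *)
Lemma normal_prob_scaled_tail D t s L : 0 < D -> 0 < t -> 0 < s -> s ^+ 2 = D * t ->
  normal_prob t s `]L, +oo[ = (scaled_tail (L / D) (t / D))%:E.
Proof.
move=> D0 t0 s0 sE; rewrite normal_prob_tail// /scaled_tail leNgt divr_gt0//=.
have -> : t / D = (s / D) ^+ 2 by rewrite expr_div_n sE; field; rewrite gt_eqF.
rewrite sqrtr_sqr gtr0_norm ?divr_gt0//; congr (std_tail _)%:E.
have tE : t = s ^+ 2 / D by rewrite sE; field; rewrite gt_eqF.
by rewrite {1}tE; field; rewrite !gt_eqF.
Qed.

Lemma product_measure_section_le (lam mu nu : probability (measurableTypeR R) R)
    (E : set (measurableTypeR R * measurableTypeR R)) : measurable E ->
  (forall y, (mu (xsection E y) <= nu (xsection E y))%E) ->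
  ((lam \x mu) E <= (lam \x nu) E)%E.
Proof.
move=> mE le; rewrite /product_measure1; apply: ge0_le_integral => //.
- exact: measurable_fun_xsection.
- exact: measurable_fun_xsection.
- by move=> y _; exact: le.
Qed.

End normal_comparison.

(** Both sides measure the union. Keeping sums avoids subtraction of extended reals. *)
Lemma measure_setD_exchange d (T : measurableType d) (R : realType)
    (P : probability T R) (X Y : set T) : measurable X -> measurable Y ->
  (P (Y `\` X) + P X = P (X `\` Y) + P Y)%E.
Proof.
have unionE A B : measurable A -> measurable B -> (P (B `\` A) + P A = P (A `|` B))%E.
  move=> mA mB; rewrite -measureU//; [|exact: measurableD|by rewrite setIC setDIK].
  congr (P _); apply/seteqP; split=> w /=; first by case=> [[]|]; [right|left].
  by case=> [|Bw]; [right|have [|] := pselect (A w); [right|left]].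
by move=> mX mY; rewrite !unionE// setUC.
Qed.


Theorem proposition5 (d : measure_display) (T : measurableType d)
    (R : realType) (P : probability T R) (Q : R) (I : finType) (S : {set I})
    (xi : I -> {RV P >-> R}) (mu : I -> nat) (sigma : I -> R) (D : R)
    (Q_gt0 : 0 < Q)
    (indep : independent_on S xi)
    (normal : forall i, i \in S -> has_normal_law (xi i) (mu i)%:R (sigma i))
    (mu_gt0 : forall i, i \in S -> (0 < mu i)%N)
    (dispersion : forall i, i \in S -> sigma i ^+ 2 / (mu i)%:R = D)
    (D_le1 : D <= 1)
    (total : (\sum_(i in S) mu i)%:R <= Q) :
  monotonicity_condition Q S xi.
Proof.
move=> a b aS bS ab U US l l_gt0; set L := l%:R * Q.
have nsig i : i \in S -> 0 < sigma i by move=> /normal[].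
have nmu i : i \in S -> 1 <= (mu i)%:R :> R by move=> /mu_gt0; rewrite ler1n.
have D_gt0 : 0 < D.
  rewrite -(dispersion _ aS) divr_gt0 ?exprn_gt0 ?nsig//.
  exact: lt_le_trans (nmu a aS).
have sigE i : i \in S -> sigma i ^+ 2 = D * (mu i)%:R.
  move=> iS; rewrite -(dispersion _ iS) divfK// gt_eqF//.
  exact: lt_le_trans (nmu i iS).
pose M (V : {set I}) : R := \sum_(i in V) (mu i)%:R.
pose F (V : {set I}) w := \sum_(i in V) xi i w.
pose E (V : {set I}) := [set w | L < F V w].
have QL : Q <= L by rewrite ler_peMl ?ler1n// ltW.
have L_gt0 : 0 < L by exact: lt_le_trans QL.
have sVE (V : {set I}) : V \subset S -> \sum_(i in V) sigma i ^+ 2 = D * M V.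
  move=> VS; rewrite /M mulr_sumr; apply: eq_bigr => i iV.
  by rewrite sigE// (fintype.subsetP VS).
have M_gt0 (V : {set I}) : V \subset S -> V != finset.set0 -> 0 < M V.
  move=> VS /set0Pn[i iV]; rewrite /M (bigD1 i)//= ltr_pwDl ?sumr_ge0//.
  by apply: lt_le_trans (nmu i _) => //; exact: (fintype.subsetP VS).
have s_gt0 (V : {set I}) : V \subset S -> V != finset.set0 -> 0 < Num.sqrt (D * M V).
  by move=> VS V0; rewrite sqrtr_gt0 mulr_gt0// M_gt0.
have s2E (V : {set I}) : Num.sqrt (D * M V) ^+ 2 = D * M V.
  by rewrite sqr_sqrtr// mulr_ge0 ?(ltW D_gt0)// sumr_ge0.
have EE V : E V = (fun w => \sum_(i in V) xi i w) @^-1` `]L, +oo[.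
  by apply/seteqP; split=> w; rewrite /= in_itv/= andbT.
have mE V : measurable (E V).
  by rewrite EE -[X in measurable X]setTI; apply: measurable_sum_on.
have F0 : E finset.set0 = set0.
  by apply/seteqP; split=> // w; rewrite /E/= /F big_set0 ltNge (ltW L_gt0).
have tailE (V : {set I}) : V \subset S -> P (E V) = (scaled_tail (L / D) (M V / D))%:E.
  (* The empty sum is constantly 0 and not normal; its tail event is empty as [L > 0], which matches
     the value of [scaled_tail] at 0. *)
  move=> VS; have [->|V0] := eqVneq V finset.set0.
    by rewrite F0 measure0 /M big_set0 mul0r /scaled_tail lexx.
  rewrite EE (normal_sum_law1 indep normal)// sVE//.
  by apply: normal_prob_scaled_tail => //; [exact: M_gt0|exact: s_gt0].
have US' : U \subset S by rewrite (fintype.subset_trans US)// finset.subsetDl.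
have [aU bU] : a \notin U /\ b \notin U.
  by split; apply/negP => /(fintype.subsetP US); rewrite !inE eqxx ?orbT.
set Ua := (a |: U)%SET; set Ub := (b |: U)%SET; set Uab := (b |: Ua)%SET.
have bUa : b \notin Ua by rewrite !inE negb_or eq_sym ab.
have UaS : Ua \subset S by rewrite finset.subUset finset.sub1set aS.
have UbS : Ub \subset S by rewrite finset.subUset finset.sub1set bS.
have UabS : Uab \subset S by rewrite finset.subUset finset.sub1set bS.
have Ua0 : Ua != finset.set0 by apply/set0Pn; exists a; rewrite setU11.
have MU1 k (V : {set I}) : k \notin V -> M (k |: V)%SET = M V + (mu k)%:R.
  by move=> kV; rewrite /M big_setU1//= addrC.
have FU1 k (V : {set I}) w : k \notin V -> F (k |: V)%SET w = F V w + xi k w.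
  by move=> kV; rewrite /F big_setU1//= addrC.
have ML : M U + (mu a)%:R + (mu b)%:R <= L.
  rewrite -!MU1//; apply: le_trans QL; apply: le_trans total; rewrite natr_sum.
  rewrite [leRHS](big_setID Uab)/= (finset.setIidPr UabS) lerDl.
  by rewrite sumr_ge0.
have -> : [set w | (\sum_(i in U) xi i w <= L)%R /\
    (L < \sum_(i in U) xi i w + xi b w)%R] = E Ub `\` E U.
  apply/seteqP; split=> w; rewrite /E/= FU1// => -[h1 h2]; split=> //.
    by apply/negP; rewrite -leNgt.
  by rewrite leNgt; exact/negP.
have -> : [set w | (\sum_(i in U) xi i w + xi a w <= L)%R /\
    (L < \sum_(i in U) xi i w + xi a w + xi b w)%R] = E Uab `\` E Ua.
  apply/seteqP; split=> w; rewrite /E/= !FU1// => -[h1 h2]; split=> //.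
    by apply/negP; rewrite -leNgt.
  by rewrite leNgt; exact/negP.
(* A normal demand can be negative, so adding [xi b] may bring a sum above [L] back to at most [L].
   In [G] the first coordinate is [xi b]; its sections lie beyond [L], where the law with the larger
   mean dominates. *)
have over : (P (E U `\` E Ub) <= P (E Ua `\` E Uab))%E.
  have [->|U0] := eqVneq U finset.set0; first by rewrite F0 set0D measure0.
  pose G := [set p : measurableTypeR R * measurableTypeR R | L < p.2 /\ p.1 + p.2 <= L].
  have mG : measurable G.
    rewrite (_ : G = (setT `*` `]L, +oo[) `&` [set p | `]-oo, L]%classic (p.1 + p.2)]).
      by apply: measurableI; [exact: measurableX|exact: measurable_preimage_add].
    by apply/seteqP; split=> p /=; rewrite !in_itv/= andbT => -[]// [].
  have overE (V : {set I}) : V \subset S -> V != finset.set0 -> b \notin V ->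
      P (E V `\` E (b |: V)%SET) =
      (normal_prob (mu b)%:R (sigma b) \x normal_prob (M V) (Num.sqrt (D * M V)))%E G.
    move=> VS V0 bV; rewrite -sVE// -(normal_sum_pair_law indep normal)//.
    congr (P _); apply/seteqP; split=> w; rewrite /E/= FU1// /F addrC.
      by move=> [LV /negP]; rewrite -leNgt.
    by move=> [LV]; rewrite leNgt => /negP.
  rewrite (overE U US' U0 bU : P (E U `\` E Ub) = _).
  rewrite (overE Ua UaS Ua0 bUa : P (E Ua `\` E Uab) = _).
  have leG y : (normal_prob (M U) (Num.sqrt (D * M U)) (xsection G y) <=
      normal_prob (M Ua) (Num.sqrt (D * M Ua)) (xsection G y))%E.
    have UaE : M Ua = M U + (mu a)%:R by exact: MU1.
    rewrite {1}UaE; apply: (@normal_prob_le _ D _ _ _ _ L) => //.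
    - exact: M_gt0.
    - exact: s_gt0.
    - exact: s_gt0.
    - by rewrite s2E UaE.
    (* The margin 1 needed below [L] is provided by the mean of [b]. *)
    - by apply: le_trans ML; rewrite lerD2l nmu.
    - exact: measurable_xsection.
    - by move=> z; rewrite /xsection/= inE /G/= in_itv/= andbT => -[].
  exact: (product_measure_section_le (normal_prob (mu b)%:R (sigma b))
    (mu := normal_prob (M U) (Num.sqrt (D * M U)))
    (nu := normal_prob (M Ua) (Num.sqrt (D * M Ua))) mG leG).
have finP X Y : exists p, P (E X `\` E Y) = p%:E.
  exists (fine (P (E X `\` E Y))); rewrite fineK// fin_num_measure//.
  exact: measurableD.
(* Integer means and [D <= 1] give the rescaled increments of size at least 1 that supermodularity
   requires. *)
have muD_ge1 i : i \in S -> 1 <= (mu i)%:R / D.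
  by move=> iS; rewrite ler_pdivlMr// mul1r (le_trans D_le1)// nmu.
have MUD : 0 <= M U / D by rewrite divr_ge0 ?(ltW D_gt0)// sumr_ge0.
have MLD : M U / D + (mu a)%:R / D + (mu b)%:R / D <= L / D.
  by rewrite -!mulrDl ler_pM2r ?invr_gt0.
(* The exchange identities write each crossing probability as a difference of tails plus an
   overshoot; supermodularity compares the differences and [over] the overshoots. *)
have := scaled_tail_supermodular MUD (muD_ge1 _ aS) (muD_ge1 _ bS) MLD.
have := measure_setD_exchange P (mE U) (mE Ub).
have := measure_setD_exchange P (mE Ua) (mE Uab).
move: over.
rewrite (tailE _ US') (tailE _ UaS) (tailE _ UbS) (tailE _ UabS).
rewrite -!mulrDl -(MU1 _ _ aU) -(MU1 _ _ bU) -(MU1 _ _ bUa).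
have [p1 ->] := finP U Ub; have [p2 ->] := finP Ua Uab.
have [p3 ->] := finP Ub U; have [p4 ->] := finP Uab Ua.
rewrite -!EFinD !lee_fin -/Ua -/Ub -/Uab; move: (scaled_tail _) => H o [h1] [h2] h3.
clear -o h1 h2 h3; lra.
Qed.
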